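(* Let $f:[0,\infty)\to[0,\infty)$ be $2$-radical convex. Then $$3\int_0^{\frac14}f(x)\,dx+\int_{\frac14}^{\frac34}f(x)\,dx\le \int_{\frac34}^1 f(x)\,dx.$$
   Context: Let $p\ge 1$. A continuous function $f:[0,\infty)\to[0,\infty)$ with $f(0)=0$ is called $p$-radical convex if the function $x\mapsto f\left(x^{1/p}\right)$ is convex on $[0,\infty)$. In particular $f$ is $2$-radical convex if $x\mapsto f(\sqrt{x})$ is convex on $[0,\infty)$. *)

(* Defs.v *)
From mathcomp Require Import all_boot all_order all_algebra.
From mathcomp Require Import all_classical all_reals all_analysis.
Import Order.TTheory GRing.Theory Num.Theory.
Import numFieldNormedType.Exports.

Set Implicit Arguments.
Unset Strict Implicit.
Unset Printing Implicit Defensive.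

Local Open Scope classical_set_scope.
Local Open Scope ring_scope.

(* A function [0, oo) -> [0, oo) is represented by a total f : R -> R of which
   only the restriction to `[0, +oo[ is constrained. As powR satisfies
   0 `^ a = 0 for a != 0, x `^ p^-1 is the p-th root of x, also at x = 0. *)
Definition radical_convex (R : realType) (p : R) (f : R -> R) : Prop :=
  [/\ 1 <= p,
      forall x : R, 0 <= x -> 0 <= f x,
      {within `[0, +oo[, continuous f},
      f 0 = 0 &
      convex_function (`[0, +oo[ : set R^o) (fun x : R^o => f (x `^ p^-1) : R^o)].

(* Main.v *)
Require Import Defs.
From mathcomp Require Import all_boot all_order all_algebra.
From mathcomp Require Import all_classical all_reals all_analysis.
From mathcomp Require Import ring lra.
Import Order.TTheory GRing.Theory Num.Theory.
Import numFieldNormedType.Exports.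

Local Open Scope classical_set_scope.
Local Open Scope ring_scope.

(** Write f x = g (x ^ 2).  A convex g >= 0 with g 0 = 0 is nondecreasing and
    superadditive, and for 0 <= s <= 1/4 one has
    3 s^2 + (1/2 - s)^2 + (1/2 + s)^2 <= (3/4 + s)^2
    (the difference of the two sides is convex in s: check s = 0 and s = 1/4).  Hence
    3 f(s) + f(1/2 - s) + f(1/2 + s) <= f(3/4 + s), and integrating over s in
    [0, 1/4] gives the claim. *)

Section RadicalConvexTwo.
Variables (R : realType) (f : R -> R).
Hypothesis hf : radical_convex 2 f.

(** Convexity on the segment from 0 to [x]: the endpoint 0 contributes nothing because [f 0 = 0]. *)
Lemma radical_convex2_scale (t x : R) : 0 <= t <= 1 -> 0 <= x ->
  f (Num.sqrt (t * x)) <= t * f (Num.sqrt x).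
Proof.
case: hf => _ _ _ f0 cf /andP[t0 t1] x0.
have t01 : Itv.spec (@Itv.num_sem R) (Itv.Real `[0%Z, 1%Z]) t.
  by apply/and3P; split; rewrite /= ?num_real ?in_itv//= ?t0 ?t1.
have : f ((t * x + (1 - t) * 0) `^ 2^-1)
    <= t * f (x `^ 2^-1) + (1 - t) * f (0 `^ 2^-1).
  by apply: (cf (Itv.mk t01) x 0); rewrite inE/= in_itv/= ?x0 ?lexx.
by rewrite mulr0 addr0 !powR12_sqrt// ?mulr_ge0// sqrtr0 f0 mulr0 addr0.
Qed.

(** Both [a] and [b] are fractions of [a + b], and these fractions sum to 1, so adding the two
    scaling bounds suffices. The case [a + b = 0] is split off because of the division. *)
Lemma radical_convex2_superadd (a b : R) : 0 <= a -> 0 <= b ->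
  f (Num.sqrt a) + f (Num.sqrt b) <= f (Num.sqrt (a + b)).
Proof.
move=> a0 b0; have ab0 : 0 <= a + b by rewrite addr_ge0.
case: hf => _ _ _ f0 _.
have [ab|ab] := eqVneq (a + b) 0.
  have -> : a = 0 by lra.
  have -> : b = 0 by lra.
  by rewrite addr0 sqrtr0 f0 addr0.
have abP : 0 < a + b by rewrite lt_neqAle eq_sym ab.
have scale c : 0 <= c <= a + b ->
    f (Num.sqrt c) <= c / (a + b) * f (Num.sqrt (a + b)).
  move=> /andP[c0 cab].
  have := @radical_convex2_scale (c / (a + b)) (a + b).
  rewrite divfK//; apply => //.
  by rewrite divr_ge0//= ler_pdivrMr// mul1r.
have ha := scale a ltac:(lra); have hb := scale b ltac:(lra).
apply: le_trans (lerD ha hb) _.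
by rewrite -mulrDl -mulrDl divff// mul1r.
Qed.

Lemma radical_convex2_mono (a b : R) : 0 <= a <= b ->
  f (Num.sqrt a) <= f (Num.sqrt b).
Proof.
move=> /andP[a0 ab]; have := @radical_convex2_superadd a (b - a) a0.
rewrite subrKC subr_ge0 => /(_ ab); apply: le_trans.
by rewrite lerDl; case: hf => _ + _ _ _; apply; rewrite sqrtr_ge0.
Qed.

Lemma radical_convex2_pointwise (s : R) : 0 <= s <= 4^-1 ->
  3 * f s + f (2^-1 - s) + f (2^-1 + s) <= f (3 / 4 + s).
Proof.
move=> /andP[s0 s4].
have sqrtE x : 0 <= x -> f x = f (Num.sqrt (x ^+ 2)).
  by move=> x0; rewrite sqrtr_sqr ger0_norm.
have p0 : 0 <= s ^+ 2 by rewrite sqr_ge0.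
have m0 : 0 <= (2^-1 - s) ^+ 2 by rewrite sqr_ge0.
have q0 : 0 <= (2^-1 + s) ^+ 2 by rewrite sqr_ge0.
rewrite (sqrtE s) ?(sqrtE (2^-1 - s)) ?(sqrtE (2^-1 + s)) ?(sqrtE (3 / 4 + s));
  try lra.
set p := s ^+ 2 in p0 *; set m := (_ - _) ^+ 2 in m0 *.
set q := (2^-1 + s) ^+ 2 in q0 *.
(* The five squares are merged one at a time, so that the left side is bounded by [f] at the root of
   their sum. *)
have h1 := @radical_convex2_superadd p p p0 p0.
have h2 := @radical_convex2_superadd (p + p) p ltac:(lra) p0.
have h3 := @radical_convex2_superadd (p + p + p) m ltac:(lra) m0.
have h4 := @radical_convex2_superadd (p + p + p + m) q ltac:(lra) q0.
have h5 : f (Num.sqrt (p + p + p + m + q)) <= f (Num.sqrt ((3 / 4 + s) ^+ 2)).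
  apply: radical_convex2_mono; apply/andP; split; first lra.
  (* Expanded, this reads 4 s^2 <= 3 s / 2 + 1 / 16, and 4 s^2 <= s since s <= 1/4. *)
  rewrite /p /m /q; nra.
lra.
Qed.

(** The norm takes its values in the half-line, so continuity of [f] within [[0, +oo[] is enough,
    even at 0, where nothing is known about [f] on the left. *)
Lemma radical_convex2_continuous_norm : continuous (fun x : R => f `|x|).
Proof.
case: hf => _ _ + _ _ => /subspace_continuousP cf x.
apply: (@cvg_comp _ _ _ Num.norm f _ (within `[0, +oo[ (nbhs `|x|))).
  move=> U AU; have := @norm_continuous R R^o x _ AU.
  apply: (@filterS _ (nbhs x)) => y.
  by apply; rewrite /= in_itv/= normr_ge0.
by apply: (cf `|x|); rewrite /= in_itv/= normr_ge0.
Qed.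

End RadicalConvexTwo.

Section ContinuousRintegral.
Variable R : realType.
Notation mu := (@lebesgue_measure R).
Implicit Types (h : R -> R) (a b c : R).

Lemma continuous_integrable_itvcc h a b : continuous h ->
  mu.-integrable `[a, b] (EFin \o h).
Proof.
move=> ch; apply: continuous_compact_integrable; first exact: segment_compact.
exact: continuous_subspaceT.
Qed.

Lemma Rintegral_itv_cat h a b c : continuous h -> a <= b <= c ->
  \int[mu]_(x in `[a, c]) h x =
    \int[mu]_(x in `[a, b]) h x + \int[mu]_(x in `[b, c]) h x.
Proof.
move=> ch /andP[ab bc].
(* Subtracting the integral over [[a, b]] leaves the half-open interval from [b] to [c]; dropping
   the endpoint [b] does not change the integral. *)
rewrite -(@Rintegral_itv_obnd_cbnd _ b); last first.
  apply: integrableS (continuous_integrable_itvcc h b c ch) => //.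
  exact: subset_itv_oc_cc.
rewrite -(@Rintegral_itvB _ h (BLeft a) (BRight c) b) ?bnd_simp//; first ring.
exact: continuous_integrable_itvcc.
Qed.

Lemma Rintegral_shift h c a : continuous h -> 0 <= a ->
  \int[mu]_(x in `[c, c + a]) h x = \int[mu]_(x in `[0, a]) h (c + x).
Proof.
move=> ch a0; rewrite /Rintegral; congr fine.
have D1 : derive1 (fun x : R => c + x) = cst 1.
  by apply/funext => x; rewrite derive1E deriveD// derive_cst derive_id add0r.
have cF : continuous (fun x : R => c + x).
  by move=> x; apply: cvgD; [exact: cvg_cst|exact: cvg_id].
have := @integration_by_substitution_increasing R (fun x => c + x) h 0 a a0.
rewrite addr0 => ->.
- by apply: eq_integral => x _; rewrite D1 /= mulr1.
- by move=> x y _ _; rewrite ltrD2l.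
- by rewrite D1 => ? _; exact: cvg_cst.
- by rewrite D1; exact: is_cvg_cst.
- by rewrite D1; exact: is_cvg_cst.
- split => //.
  + by apply: cvg_at_right_filter; exact: cF.
  + by apply: cvg_at_left_filter; exact: cF.
- exact: continuous_subspaceT.
Qed.

Lemma Rintegral_reflect h c a : continuous h -> 0 <= a ->
  \int[mu]_(x in `[c - a, c]) h x = \int[mu]_(x in `[0, a]) h (c - x).
Proof.
move=> ch a0.
have cN : continuous (fun x => h (c + x)).
  move=> x; apply: continuous_comp; last exact: ch.
  by apply: cvgD; [exact: cvg_cst|exact: cvg_id].
rewrite -[in LHS](subrK a c) addrK Rintegral_shift//.
(* A second shift, now based at [- a], centres the interval at the point of reflection; [- 0] is
   kept to match the substitution of [- x] for [x]. *)
transitivity (\int[mu]_(x in `[- a, - 0]) h (c + x)).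
  rewrite -[in RHS](subrr a) opprB [in RHS]addrC Rintegral_shift//.
    by apply: eq_Rintegral => x _; rewrite addrA.
rewrite /Rintegral; congr fine.
rewrite (@integration_by_substitution_oppr _ (fun x => h (c + x)))//.
exact: continuous_subspaceT.
Qed.

End ContinuousRintegral.

Theorem corollary2p4 (R : realType) (f : R -> R) (hf : radical_convex 2 f) :
  3 * (\int[lebesgue_measure]_(x in `[0, 4^-1]) f x)
    + \int[lebesgue_measure]_(x in `[4^-1, 3 / 4]) f x
  <= \int[lebesgue_measure]_(x in `[3 / 4, 1]) f x.
Proof.
(* Unlike f, its even extension h is continuous on the whole line. *)
pose h (x : R) := f `|x|.
have ch : continuous h := radical_convex2_continuous_norm _ _ hf.
have toh a b : 0 <= a -> \int[lebesgue_measure]_(x in `[a, b]) f x =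
    \int[lebesgue_measure]_(x in `[a, b]) h x.
  move=> a0; apply: eq_Rintegral => x; rewrite inE/= in_itv/= => /andP[ax _].
  by rewrite /h ger0_norm// (le_trans a0).
have hE x : 0 <= x -> h x = f x by move=> x0; rewrite /h ger0_norm.
rewrite !toh; try lra.
have cshift c : continuous (fun x => h (c + x)).
  move=> x; apply: continuous_comp; last exact: ch.
  by apply: cvgD; [exact: cvg_cst|exact: cvg_id].
have crefl c : continuous (fun x => h (c - x)).
  move=> x; apply: continuous_comp; last exact: ch.
  by apply: cvgB; [exact: cvg_cst|exact: cvg_id].
have q0 : 0 <= 4^-1 :> R by lra.
(* The middle interval is cut at 1/2. Reflecting its left half and shifting its right half and the
   last interval brings every integral to [0, 1/4], with the arguments 1/2 - s, 1/2 + s and 3/4 + s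
   of the pointwise bound. *)
rewrite (@Rintegral_itv_cat _ _ 4^-1 2^-1)//; last lra.
have := @Rintegral_reflect _ _ 2^-1 _ ch q0.
rewrite (_ : 2^-1 - 4^-1 = 4^-1 :> R); last lra.
move=> ->.
have := @Rintegral_shift _ _ 2^-1 _ ch q0.
rewrite (_ : 2^-1 + 4^-1 = 3 / 4 :> R); last lra.
move=> ->.
have := @Rintegral_shift _ _ (3 / 4) _ ch q0.
rewrite (_ : 3 / 4 + 4^-1 = 1 :> R); last lra.
move=> ->.
have int g : continuous g ->
    lebesgue_measure.-integrable `[0, 4^-1] (EFin \o g : R -> \bar R).
  exact: continuous_integrable_itvcc.
have c3 : continuous (fun x => 3 * h x).
  by move=> x; apply: cvgM; [exact: cvg_cst|exact: ch].
have cD (g k : R -> R) : continuous g -> continuous k ->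
    continuous (fun x => g x + k x).
  by move=> cg ck x; apply: cvgD; [exact: cg|exact: ck].
rewrite -RintegralZl//; last exact: int.
rewrite addrA -!RintegralD//; try exact: int.
  apply: le_Rintegral => //; try exact: int.
    exact: (int _ (cD _ _ (cD _ _ c3 (crefl _)) (cshift _))).
  move=> x; rewrite /= in_itv/= => /andP[x0 x4].
  rewrite !hE; try lra.
  by apply: radical_convex2_pointwise; rewrite ?x0.
exact: (int _ (cD _ _ c3 (crefl _))).
Qed.
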